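(* Let $I=[0,1)$, let $-1<\lambda<1$, and let $f\colon I\to I$ be a piecewise $\lambda$-affine map. For $\delta\in\mathbb{R}$ let $f_\delta = R_\delta\circ f\colon I\to I$, where $R_\delta(x)=\{x+\delta\}$, and let $$\mathcal{E}_f=\{\delta\in\mathbb{R}\colon f_\delta\text{ is not asymptotically periodic}\}.$$ Then $\dim_H\mathcal{E}_f=0$, where $\dim_H$ denotes Hausdorff dimension.
   Context: A map $f\colon I\to I$, $I=[0,1)$, is piecewise $\lambda$-affine if there exist an integer $k\geq 2$, real numbers $b_1,\ldots,b_k$ and a partition $0=a_0<a_1<\cdots<a_{k-1}<a_k=1$ such that $f(x)=\lambda x+b_i$ for every $x\in[a_{i-1},a_i)$ and every $i=1,\ldots,k$. $\{\cdot\}$ denotes the fractional part, so $R_\delta\colon I\to I$ is the rotation of angle $\delta$. For a map $h\colon I\to I$ and $x\in I$, the $\omega$-limit set $\omega(h,x)$ is the set of accumulation points of the forward orbit (the sequence $(h^n(x))_{n\ge 0}$) of $x$ under $h$. The map $h$ is asymptotically periodic if $h$ has at most a finite number of periodic orbits and, for every $x\in I$, $\omega(h,x)$ is a periodic orbit of $h$. *)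

(* Defs.v *)
From HB Require Import structures.
From mathcomp Require Import all_boot all_order all_algebra.
From mathcomp Require Import all_classical all_reals all_analysis.

Set Implicit Arguments.
Unset Strict Implicit.
Unset Printing Implicit Defensive.
Import Order.TTheory GRing.Theory Num.Theory.
Import numFieldNormedType.Exports.

Local Open Scope classical_set_scope.
Local Open Scope ring_scope.

Section HausdorffDimension.
Variable R : realType.
Local Open Scope ereal_scope.

Definition diameter (U : set R) : \bar R :=
  ereal_sup [set (`|p.1 - p.2|%R : R)%:E | p in U `*` U].

(* The case split makes empty covering sets contribute 0 also when s = 0,
   where poweR would give 1. *)
Definition gauge_pow (s : R) (U : set R) : \bar R :=
  if U == set0 then 0 else poweR (diameter U) s.

Definition hausdorff_premeasure (s e : R) (E : set R) : \bar R :=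
  ereal_inf [set \sum_(n <oo) gauge_pow s (U n) | U in
    [set U : (set R)^nat |
      (forall n, diameter (U n) <= e%:E) /\ E `<=` \bigcup_n U n]].

(* The premeasure is nonincreasing in e, so this supremum is its limit as e
   tends to 0. *)
Definition hausdorff_measure (s : R) (E : set R) : \bar R :=
  ereal_sup [set hausdorff_premeasure s e E | e in [set e : R | (0 < e)%R]].

Definition hausdorff_dim (E : set R) : \bar R :=
  ereal_inf [set s%:E | s in
    [set s : R | (0 <= s)%R /\ hausdorff_measure s E = 0]].

End HausdorffDimension.

(* A self-map of [0, 1) is represented by a function R -> R preserving
   [0, 1); all notions below depend only on its values on [0, 1). *)
Section IntervalMaps.
Variable R : realType.
Implicit Types (f h : R -> R) (x delta lambda : R).

Definition unit_ico : set R := `[0, 1[%classic.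

(* b i is the constant on [a i, a i.+1), i < k. *)
Definition piecewise_affine lambda f : Prop :=
  set_fun unit_ico unit_ico f /\
  exists (k : nat) (a b : nat -> R),
    [/\ (2 <= k)%N, a 0%N = 0, a k = 1,
        (forall i, (i < k)%N -> a i < a i.+1) &
        (forall i, (i < k)%N ->
           forall x, a i <= x < a i.+1 -> f x = lambda * x + b i)].

Definition fractional_part x : R := x - (Num.floor x)%:~R.

Definition rotation delta x : R := fractional_part (x + delta).

Definition periodic_orbit h (O : set R) : Prop :=
  exists p : R, [/\ unit_ico p,
    (exists2 n : nat, (0 < n)%N & iter n h p = p) &
    O = range (fun n : nat => iter n h p)].

(* Accumulation points of the sequence (h^n x)_n in the phase space [0, 1). *)
Definition omega_limit h x : set R :=
  unit_ico `&` cluster ((fun n : nat => iter n h x) @ \oo).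

Definition asymptotically_periodic h : Prop :=
  finite_set [set O : set R | periodic_orbit h O] /\
  (forall x, unit_ico x -> periodic_orbit h (omega_limit h x)).

Definition exceptional_set f : set R :=
  [set delta : R | ~ asymptotically_periodic (rotation delta \o f)].

End IntervalMaps.

(* Main.v *)
(** On the n-th iterate, f_delta acts by h^n(x) = lambda^n x + sigma_n delta + c,
    where sigma_n = 1 + ... + lambda^(n-1) is the same for all branches and the
    offset c is locally constant in (delta, x).

    If, for some n, the image h^n([0, 1)) stays away from the breakpoints a_0,
    ..., a_k, then h is an affine contraction near each point of that image and
    all orbits are attracted by finitely many periodic orbits.  So if delta is
    exceptional then for every n some h^n(x) is within theta^n of a breakpoint,
    where |lambda| <= theta < 1, and each value of the offset c confines such
    delta to (k + 1) sets of diameter O(theta^n).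

    It remains to see that the number of offsets grows subexponentially.  In a
    tiny region of the (delta, x)-plane, only one discontinuity line per time
    level matters during N steps, since the lines of one level are parallel and
    finitely many.  Hence the offset at time N is determined by the sides of
    N + 1 lines, which gives O(N^2) values.  Regions stay tiny under iteration,
    so there are O(P(N)^t) offsets at time t N with P quadratic, and P(N)^(1/N)
    tends to 1. *)

Require Import Defs.
From mathcomp Require Import all_boot all_order all_algebra.
From mathcomp Require Import all_classical all_reals all_analysis.
From mathcomp Require Import ring lra zify.
Set Implicit Arguments.
Unset Strict Implicit.
Unset Printing Implicit Defensive.
Import Order.TTheory GRing.Theory Num.Theory.
Import numFieldNormedType.Exports.
Local Open Scope classical_set_scope.
Local Open Scope ring_scope.

(** * Sets of Hausdorff measure zero *)

Section HausdorffNull.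
Variable R : realType.
Implicit Types (s e d : R) (E U : set R).
Local Open Scope ereal_scope.

Lemma gauge_pow_ge0 s U : 0 <= gauge_pow s U.
Proof. by rewrite /gauge_pow; case: ifP => // _; exact: poweR_ge0. Qed.

Lemma hausdorff_premeasure_ge0 s e E : 0 <= hausdorff_premeasure s e E.
Proof.
apply: le_ereal_inf_tmp => _ [U _ <-].
by apply: nneseries_ge0 => n _ _; exact: gauge_pow_ge0.
Qed.

Lemma diameter_le U d : (forall x y, U x -> U y -> `|x - y| <= d)%R ->
  diameter U <= d%:E.
Proof.
by move=> Ud; apply: ge_ereal_sup => _ [[x y] [/= Ux Uy] <-]; rewrite lee_fin; exact: Ud.
Qed.

Lemma gauge_pow_le s d U : (0 <= s)%R -> (0 <= d)%R ->
  diameter U <= d%:E -> gauge_pow s U <= (d `^ s)%:E.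
Proof.
move=> s0 d0 Ud; rewrite /gauge_pow; case: ifPn => [_|/set0P[x Ux]].
  by rewrite lee_fin powR_ge0.
have U0 : 0 <= diameter U.
  by apply: ereal_sup_ubound; exists (x, x) => //=; rewrite subrr normr0.
rewrite -poweR_EFin; apply: gt0_ler_poweR => //; rewrite in_itv/= ?U0 ?leey//.
by rewrite lee_fin d0.
Qed.

Lemma hausdorff_measure_eq0 s E :
  (forall e eta, (0 < e)%R -> (0 < eta)%R ->
    hausdorff_premeasure s e E <= eta%:E) -> hausdorff_measure s E = 0.
Proof.
move=> small; apply/eqP; rewrite eq_le; apply/andP; split; last first.
  apply: le_trans (hausdorff_premeasure_ge0 s 1 E) _.
  by apply: ereal_sup_ubound; exists 1%R => //=; exact: ltr01.
apply: ge_ereal_sup => _ [e /= e0 <-].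
by apply/lee_addgt0Pr => eta eta0; rewrite add0e; exact: small.
Qed.

Lemma hausdorff_dim_eq0 E :
  (forall s, (0 < s)%R -> hausdorff_measure s E = 0) -> hausdorff_dim E = 0.
Proof.
move=> null; apply/eqP; rewrite eq_le; apply/andP; split; last first.
  by apply: le_ereal_inf_tmp => _ [s [s0 _] <-]; rewrite lee_fin.
apply/lee_addgt0Pr => s s0; rewrite add0e.
by apply: ereal_inf_lbound; exists s => //=; split; [exact: ltW|exact: null].
Qed.

Lemma hausdorff_premeasure_finite_cover s e E (l : seq (set R)) d :
  (0 <= s)%R -> (0 <= d <= e)%R ->
  (forall U, U \in l -> diameter U <= d%:E) ->
  (forall x, E x -> exists2 U, U \in l & U x) ->
  hausdorff_premeasure s e E <= ((size l)%:R * d `^ s)%:E.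
Proof.
move=> s0 /andP[d0 de] ld El.
have diam0 : diameter (set0 : set R) <= d%:E by apply: diameter_le => x y [].
have lnd n : diameter (nth set0 l n) <= d%:E.
  have [nl|nl] := ltnP n (size l); last by rewrite nth_default.
  by apply: ld; exact: mem_nth.
apply: (@le_trans _ _ (\sum_(n <oo) gauge_pow s (nth set0 l n))).
  apply: ereal_inf_lbound; exists (nth set0 l) => //=; split.
    by move=> n; apply: le_trans (lnd n) _; rewrite lee_fin.
  move=> x /El[U Ul Ux]; exists (index U l) => //.
  by rewrite nth_index.
rewrite (nneseries_split 0 (size l)); last by move=> *; exact: gauge_pow_ge0.
(* Past the end of the list [nth] returns [set0], which contributes 0. *)
rewrite [X in _ + X]eseries0 ?adde0; last first.
  move=> i; rewrite add0n => li _.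
  by rewrite nth_default// /gauge_pow eqxx.
rewrite add0n; apply: (@le_trans _ _ (\sum_(0 <= i < size l) (d `^ s)%:E)).
  by apply: lee_sum => i _; exact: gauge_pow_le.
by rewrite big_mkord sumEFin sumr_const card_ord mulr_natl.
Qed.

(** Each [F i] has a cover with sum at most eta / 2^(i+1), and a bijection of [nat] with [nat * nat]
    arranges all these covers in one sequence. *)
Lemma hausdorff_measure_bigcup_eq0 s (F : (set R)^nat) :
  (forall i, hausdorff_measure s (F i) = 0) ->
  hausdorff_measure s (\bigcup_i F i) = 0.
Proof.
move=> F0; apply: hausdorff_measure_eq0 => e eta e0 eta0.
have /choice[G GP] : forall i, exists G : (set R)^nat,
    [/\ forall n, diameter (G n) <= e%:E, F i `<=` \bigcup_n G n &
        \sum_(n <oo) gauge_pow s (G n) <= (eta / (2 ^ i.+1)%:R)%:E].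
  move=> i; have : hausdorff_premeasure s e (F i) < (eta / (2 ^ i.+1)%:R)%:E.
    apply: (@le_lt_trans _ _ 0).
      by rewrite -(F0 i); apply: ereal_sup_ubound; exists e.
    by rewrite lte_fin divr_gt0// ltr0n expn_gt0.
  by move=> /ereal_inf_lt[_ [G [Ge FG] <-]] /ltW; exists G.
pose g (p : nat * nat) := gauge_pow s (G p.1 p.2).
have g0 p : 0 <= g p by exact: gauge_pow_ge0.
have /card_esym/ppcard_eqP[f] := card_nat2.
apply: (@le_trans _ _ (\sum_(n <oo) g (f n))).
  apply: ereal_inf_lbound; exists (fun n => G (f n).1 (f n).2) => //=; split.
    by move=> n; case: (GP (f n).1).
  move=> x [i _ Fx]; have [_ /(_ _ Fx)[j _ Gx] _] := GP i.
  by exists (f^-1%FUN (i, j)) => //=; rewrite invK ?inE.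
rewrite nneseries_esumT// -(reindex_esum setT setT f g); last exact: bij.
have -> : setT = setT `*`` (fun=> setT) :> set (nat * nat).
  by apply/seteqP; split.
rewrite -(esum_esum (a := fun i j => g (i, j)))//.
apply: le_trans (epsilon_trick0 xpredT (ltW eta0)).
rewrite nneseries_esumT; last first.
  by move=> i; rewrite lee_fin divr_ge0// ltW.
apply: le_esum => i _; rewrite -nneseries_esumT//.
by case: (GP i).
Qed.

End HausdorffNull.

(** * Counting sign vectors of affine forms on the line and in the plane *)

Section SignVectors.

(** A new label [phi] splits only those values of [F] on whose fibre it is not constant. The list
    [s1] contains these and is counted twice more; elsewhere [phi] is a function of [F]. *)
Lemma labels_cons_card (T : Type) (W : set T) (F : T -> seq bool)
    (phi : T -> bool) (s s1 : seq (seq bool)) :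
  (forall p, W p -> F p \in s) ->
  (forall p q, W p -> W q -> F p = F q -> phi p -> ~~ phi q -> F p \in s1) ->
  exists2 s' : seq (seq bool), (size s' <= size s + (size s1).*2)%N &
    forall p, W p -> phi p :: F p \in s'.
Proof.
move=> Fs Fs1.
pose b v := `[< exists p, [/\ W p, F p = v & phi p] >].
exists ([seq b v :: v | v <- s] ++ [seq true :: v | v <- s1] ++
        [seq false :: v | v <- s1]).
  by rewrite !size_cat !size_map addnn.
move=> p Wp; rewrite !mem_cat.
have [Fp|Fp] := boolP (F p \in s1).
  by case: (phi p); rewrite [X in _ || X]orbC !(map_f _ Fp) ?orbT.
rewrite (_ : phi p = b (F p)) ?(map_f (fun v => b v :: v) (Fs _ Wp))//.
have [phip|phip] := boolP (phi p).
  by apply/esym/asboolP; exists p.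
apply/esym/asboolPn => -[q [Wq Fqp phiq]]; case/negP: Fp.
by rewrite -Fqp; apply: (Fs1 q p).
Qed.

Variable R : realType.

(** Both half-lines are convex, so an affine form with equal signs at two points keeps that sign on
    the segment between them. *)
Lemma segment_sign (u v c c' : R) : (0 <= v) = (0 <= u) ->
  0 <= c -> 0 <= c' -> 0 < c + c' -> (0 <= c * u + c' * v) = (0 <= u).
Proof.
move=> uv c0 c'0 cc'; have [u0|u0] := leP 0 u.
  by rewrite u0 in uv; rewrite addr_ge0// mulr_ge0.
have {uv} v0 : v < 0 by rewrite ltNge uv -ltNge.
apply/negbTE; rewrite -ltNge.
have [c00|c00] := eqVneq c 0.
  rewrite c00 mul0r add0r; rewrite c00 add0r in cc'.
  by rewrite pmulr_rlt0.
have {}c0 : 0 < c by rewrite lt_neqAle eq_sym c00.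
by rewrite -(addr0 0) ltr_leD// ?pmulr_rlt0// mulr_ge0_le0// ltW.
Qed.

Definition line_signs (L : seq (R * R)) (t : R) :=
  [seq 0 <= w.1 * t + w.2 | w <- L].

Definition plane_signs (L : seq (R * R * R)) (p : R * R) :=
  [seq 0 <= w.1.1 * p.1 + w.1.2 * p.2 + w.2 | w <- L].

(** If a new form splits a sign class, its zero lies between two points of the class, so by
    convexity the class is that of the zero. Hence each form adds at most two vectors. *)
Lemma line_signs_card (L : seq (R * R)) :
  exists2 s : seq (seq bool), (size s <= (size L).*2.+1)%N &
    forall t, line_signs L t \in s.
Proof.
elim: L => [|[a b] L [s sL Ls]]; first by exists [:: [::]].
have [|p q _ _ /= Fpq|s' ss' s'P] := @labels_cons_card R setT (line_signs L)
    (fun t => 0 <= a * t + b) s [:: line_signs L (- b / a)].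
- by move=> t _; exact: Ls.
- move=> phip; rewrite -ltNge => phiq; rewrite inE; apply/eqP.
  have a0 : a != 0.
    by apply/eqP => a0; move: phip phiq; rewrite a0 !mul0r; lra.
  (* the zero is a barycentre of p and q, weighted by the opposite values *)
  pose c := - (a * q + b); pose c' := a * p + b.
  have c0 : 0 < c by rewrite /c oppr_gt0.
  have cc' : 0 < c + c' by rewrite /c'; lra.
  have ccE : c + c' = a * (p - q) by rewrite /c /c'; ring.
  have pq0 : p - q != 0.
    by apply: contraTneq cc' => pq; rewrite ccE pq mulr0 ltxx.
  apply/eq_in_map => -[a' b'] wL /=.
  have Epq : (0 <= a' * q + b') = (0 <= a' * p + b').
    have /eq_in_map/(_ _ wL) := Fpq; by [].
  rewrite -(segment_sign Epq (ltW c0) phip cc').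
  have -> : c * (a' * p + b') + (a * p + b) * (a' * q + b') =
            (c + c') * (a' * (- b / a) + b').
    by rewrite /c /c'; field.
  by rewrite pmulr_rge0.
- exists s' => [|t]; last exact: s'P.
  apply: leq_trans ss' _; rewrite /= doubleS; lia.
Qed.

(** By convexity, a class split by a new line contains a point of that line, so its vector is a sign
    vector of the old forms restricted to the line. There are at most 2n + 1 of these for n old
    forms, and 2n^2 + 1 + 2(2n + 1) = 2(n + 1)^2 + 1. *)
Lemma plane_signs_card (L : seq (R * R * R)) :
  exists2 s : seq (seq bool), (size s <= 2 * (size L) ^ 2 + 1)%N &
    forall p, plane_signs L p \in s.
Proof.
elim: L => [|[[a b] c0] L [s sL Ls]]; first by exists [:: [::]].
(* p0 + t * (-b, a) parametrises the line where the new form vanishes *)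
pose n := a ^+ 2 + b ^+ 2.
pose p0 := (- c0 * a / n, - c0 * b / n).
have [s1 s1L Ls1] := line_signs_card
  [seq (w.1.2 * a - w.1.1 * b, w.1.1 * p0.1 + w.1.2 * p0.2 + w.2) | w <- L].
have [|p q _ _ /= Fpq|s' ss' s'P] := @labels_cons_card _ setT (plane_signs L)
    (fun p => 0 <= a * p.1 + b * p.2 + c0) s s1.
- by move=> t _; exact: Ls.
- move=> phip; rewrite -ltNge => phiq.
  pose c := - (a * q.1 + b * q.2 + c0); pose c' := a * p.1 + b * p.2 + c0.
  have c_gt0 : 0 < c by rewrite /c oppr_gt0.
  have cc' : 0 < c + c' by rewrite /c'; lra.
  have ccE : c + c' = a * (p.1 - q.1) + b * (p.2 - q.2) by rewrite /c /c'; ring.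
  have n0 : n != 0.
    apply: contraTneq cc' => /eqP; rewrite /n paddr_eq0 ?sqr_ge0// !sqrf_eq0.
    by move=> /andP[/eqP a0 /eqP b0]; rewrite ccE a0 b0 !mul0r addr0 ltxx.
  (* The parameter of the barycentre of [p] and [q] with weights [c] and [c'], where the new form
     vanishes. *)
  pose t := (a * (c * p.2 + c' * q.2) - b * (c * p.1 + c' * q.1)) / (n * (c + c')).
  rewrite (_ : plane_signs L p = line_signs
    [seq (w.1.2 * a - w.1.1 * b, w.1.1 * p0.1 + w.1.2 * p0.2 + w.2) | w <- L] t).
    exact: Ls1.
  rewrite /line_signs -map_comp; apply/eq_in_map => -[[a' b'] d] wL /=.
  have Epq : (0 <= a' * q.1 + b' * q.2 + d) = (0 <= a' * p.1 + b' * p.2 + d).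
    have /eq_in_map/(_ _ wL) := Fpq; by [].
  rewrite -(segment_sign Epq (ltW c_gt0) phip cc').
  set r := (X in 0 <= X); rewrite -/c'.
  have -> : r = (c + c') * ((b' * a - a' * b) * t +
      (a' * (- c0 * a / n) + b' * (- c0 * b / n) + d)).
    rewrite /r /t /c /c' /n; field.
    by apply/andP; split; [exact: n0|exact: lt0r_neq0 cc'].
  by rewrite pmulr_rge0.
- exists s' => [|t]; last exact: s'P.
  apply: leq_trans ss' _; move: s1L sL; rewrite size_map /=; nia.
Qed.

End SignVectors.

(** * Grids and the pigeonhole principle on the unit interval *)

Section Cells.
Variable R : realType.

Definition cell (e u : R) := Num.truncn (u / e).

Definition cells (e : R) := (Num.truncn e^-1).+1.

Lemma cell_lt e u : 0 < e -> 0 <= u < 1 -> (cell e u < cells e)%N.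
Proof.
move=> e0 /andP[u0 u1]; rewrite truncn_lt_nat ?divr_ge0// 1?ltW//.
apply: le_lt_trans (truncnS_gt _).
by rewrite ler_piMl ?invr_ge0// ltW.
Qed.

Lemma cell_eq_close e u v : 0 < e -> 0 <= u -> 0 <= v -> cell e u = cell e v ->
  `|u - v| <= e.
Proof.
move=> e0 u0 v0 uv; rewrite /cell in uv.
have /truncn_itv : 0 <= u / e by rewrite divr_ge0// ltW.
have /truncn_itv : 0 <= v / e by rewrite divr_ge0// ltW.
rewrite {}uv -natr1 => /andP[h1 h2] /andP[h3 h4].
rewrite -(ler_pM2r (_ : 0 < e^-1)) ?invr_gt0// divff ?gt_eqF//.
have e'0 : 0 < e^-1 by rewrite invr_gt0.
rewrite -{1}(gtr0_norm e'0) -normrM mulrBl ler_norml.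
by apply/andP; split; lra.
Qed.

Lemma cell_pigeonhole e (u : nat -> R) : 0 < e -> (forall i, 0 <= u i < 1) ->
  exists i j, (i < j)%N /\ `|u i - u j| <= e.
Proof.
move=> e0 u01; pose g (i : 'I_(cells e).+1) := Ordinal (cell_lt e0 (u01 i)).
have : ~ injective g by move/leq_card; rewrite !card_ord ltnn.
move=> /existsNP[i /existsNP[j /not_implyP[[gij] ij]]].
have cl : `|u i - u j| <= e.
  by apply: cell_eq_close gij; [|case/andP: (u01 i)|case/andP: (u01 j)].
have [ltij|ltji|/val_inj//] := ltngtP i j; first by exists i, j.
by exists j, i; rewrite distrC.
Qed.

Lemma exp_eventually_small (x e : R) : `|x| < 1 -> 0 < e ->
  exists J, forall j, (J <= j)%N -> `|x| ^+ j < e.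
Proof.
move=> /cvg_expr/cvgrPdist_lt xc e0; have [J _ JP] := xc _ e0.
by exists J => j /JP; rewrite sub0r normrN normrX.
Qed.

End Cells.

(** * Separation by thresholds, and counting values of functions *)

Section Thresholds.
Variable R : realType.

Lemma seq_pos_lower_bound (T : eqType) (s : seq T) (g : T -> R) :
  (forall t, t \in s -> 0 < g t) ->
  exists2 e : R, 0 < e & forall t, t \in s -> e <= g t.
Proof.
elim: s => [_|t s IH ts]; first by exists 1.
have [|e e0 es] := IH; first by move=> u us; apply: ts; rewrite inE us orbT.
exists (Num.min e (g t)); first by rewrite lt_min e0 ts// mem_head.
move=> u; rewrite inE => /predU1P[->|us]; first by rewrite ge_min lexx orbT.
by rewrite ge_min es.
Qed.

(** With [e] at most the least gap between distinct elements of [T], a set of diameter below [e] is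
    separated by at most one of them, and [kappa] is that one. *)
Lemma one_threshold (T : seq R) : exists2 e : R, 0 < e &
  forall V : set R, (forall v w, V v -> V w -> `|v - w| < e) ->
  exists kappa, forall v w, V v -> V w -> (kappa <= v) = (kappa <= w) ->
    forall tau, tau \in T -> (tau <= v) = (tau <= w).
Proof.
have [|e e0 eT] := @seq_pos_lower_bound _
  [seq p <- [seq (x, y) | x <- T, y <- T] | p.1 != p.2] (fun p => `|p.1 - p.2|).
  by move=> p; rewrite mem_filter normr_gt0 subr_eq0 => /andP[].
exists e => // V Ve.
have [[tau [v [w [tauT Vv Vw]]]]|nosplit] :=
    pselect (exists tau v w, [/\ tau \in T, V v, V w & (v < tau <= w)]).
  move=> /andP[vtau tauw]; exists tau => v' w' Vv' Vw' same tau' tau'T.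
  have [<-|ne] := eqVneq tau tau'; first exact: same.
  have {}eT : e <= `|tau - tau'|.
    by apply: (eT (tau, tau')); rewrite mem_filter ne; apply/allpairsP; exists (tau, tau').
  move: eT; apply: contra_leP => /eqP.
  wlog: v' w' Vv' Vw' same / v' < tau' <= w'.
    move=> wl; case: (leP tau' v'); case: (leP tau' w') => // h1 h2 _.
      by apply: (wl w' v') => //; rewrite ?h1 ?h2//= leNgt h1.
    by apply: (wl v' w') => //; rewrite ?h1 ?h2//= leNgt h2.
  move=> /andP[h1 h2] _.
  (* Both gaps satisfy tau - tau' < w - v' < e and tau' - tau < w' - v < e. *)
  have := Ve _ _ Vw Vv'; have := Ve _ _ Vw' Vv; rewrite !ltr_norml; lra.
(* No threshold separates [V], so any [kappa] will do. *)
exists 0 => v w Vv Vw _ tau tauT; apply/idP/idP => h; rewrite leNgt; apply/negP => h'.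
  by apply: nosplit; exists tau, w, v; split; rewrite ?h ?h'.
by apply: nosplit; exists tau, v, w; split; rewrite ?h ?h'.
Qed.

Lemma one_threshold_levels (T : nat -> seq R) N : exists2 e : R, 0 < e &
  forall V : nat -> set R,
  (forall j, (j <= N)%N -> forall v w, V j v -> V j w -> `|v - w| < e) ->
  exists kappa : nat -> R, forall j, (j <= N)%N ->
    forall v w, V j v -> V j w -> (kappa j <= v) = (kappa j <= w) ->
    forall tau, tau \in T j -> (tau <= v) = (tau <= w).
Proof.
have /choice[e eP] : forall j, exists e : R, 0 < e /\
  forall V : set R, (forall v w, V v -> V w -> `|v - w| < e) ->
  exists kappa, forall v w, V v -> V w -> (kappa <= v) = (kappa <= w) ->
    forall tau, tau \in T j -> (tau <= v) = (tau <= w).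
  by move=> j; have [e] := one_threshold (T j); exists e.
have [|e' e'0 e'e] := @seq_pos_lower_bound _ (iota 0 N.+1) e.
  by move=> j _; case: (eP j).
exists e' => // V VN.
have /choice[kappa kP] : forall j, exists kappa, (j <= N)%N ->
    forall v w, V j v -> V j w -> (kappa <= v) = (kappa <= w) ->
    forall tau, tau \in T j -> (tau <= v) = (tau <= w).
  move=> j; have [jN|jN] := leqP j N; last by exists 0 => jN'; lia.
  have [_ /(_ (V j))[|kappa ?]] := eP j; last by exists kappa.
  move=> v w Vv Vw; apply: lt_le_trans (VN _ jN _ _ Vv Vw) _.
  by apply: e'e; rewrite mem_iota.
by exists kappa => j jN; exact: kP.
Qed.

(* Finite cardinality bounds are phrased through lists, which may have
   repetitions or junk elements. *)
Definition takes_at_most (T : Type) (U : eqType) (g : T -> U) (S : set T) (n : nat) :=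
  exists2 l : seq U, (size l <= n)%N & forall p, S p -> g p \in l.

Lemma takes_at_most_factor (T : Type) (U V : eqType) (g : T -> U) (h : T -> V)
    (S : set T) n : takes_at_most h S n ->
  (forall p q, S p -> S q -> h p = h q -> g p = g q) -> takes_at_most g S n.
Proof.
move=> [l ln hl] hg.
have [[p0 Sp0]|S0] := pselect (exists p, S p); last first.
  by exists [::] => // p Sp; case: S0; exists p.
have /choice[r rP] : forall v, exists p, S p /\ ((exists2 q, S q & h q = v) -> h p = v).
  move=> v; have [[q Sq qv]|nq] := pselect (exists2 q, S q & h q = v).
    by exists q.
  by exists p0; split => // -[q ? ?]; case: nq; exists q.
exists [seq g (r v) | v <- l]; first by rewrite size_map.
move=> p Sp; apply/mapP; exists (h p); first exact: hl.
by apply: hg => //; [case: (rP (h p))|case: (rP (h p)) => _ ->//; exists p].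
Qed.

Lemma takes_at_most_fibers (T : Type) (U V : eqType) (g : T -> U) (h : T -> V)
    (S : set T) n m : takes_at_most h S n ->
  (forall v, takes_at_most g (S `&` [set p | h p = v]) m) ->
  takes_at_most g S (n * m).
Proof.
move=> [l ln hl] /(_ _)/cid2-/all_sig2[L Lm gL].
exists (flatten [seq L v | v <- l]).
  apply: leq_trans (leq_mul ln (leqnn m)).
  elim: l {ln hl} => //= v l IH; rewrite size_cat mulSn leq_add//.
move=> p Sp; apply/flattenP; exists (L (h p)); last exact: gL.
by apply: map_f; exact: hl.
Qed.

End Thresholds.

(** * Iterates of the rotated maps and the number of their offsets *)

Section PiecewiseAffineFamily.
Variables (R : realType) (lambda : R) (f : R -> R) (k : nat) (a b : nat -> R).
Hypothesis lambda_lt1 : `|lambda| < 1.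
Hypothesis f_unit : set_fun (@unit_ico R) (@unit_ico R) f.
Hypothesis a0 : a 0%N = 0.
Hypothesis ak : a k = 1.
Hypothesis f_affine : forall i, (i < k)%N ->
  forall x, a i <= x < a i.+1 -> f x = lambda * x + b i.
Implicit Types (delta x y : R) (n N t : nat) (z : int).

Local Notation I := (@unit_ico R).

Lemma unit_icoE x : I x = (0 <= x < 1) :> Prop.
Proof. by rewrite /unit_ico /= in_itv. Qed.

Lemma fractional_part_unit x : I (fractional_part x).
Proof.
rewrite unit_icoE /fractional_part; have := ge_floor x; have := floorD1_gt x.
by rewrite intrD; lra.
Qed.

Lemma fractional_part_eq z x : z%:~R <= x < z%:~R + 1 ->
  fractional_part x = x - z%:~R.
Proof.
move=> /andP[zx xz]; rewrite /fractional_part (@floor_def _ x z)//.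
by rewrite zx intrD.
Qed.

Definition rot delta := rotation delta \o f.

Lemma rot_iter_unit delta n x : I x -> I (iter n (rot delta) x).
Proof. by case: n => [//|n] _; exact: fractional_part_unit. Qed.

Lemma piece_exists x : I x -> exists2 i, (i < k)%N & a i <= x < a i.+1.
Proof.
rewrite unit_icoE => /andP[x0 x1].
have : x < a k by rewrite ak.
have : exists i, x < a i by exists k; rewrite ak.
move=> ex xk; have [i xi imin] := ex_minnP ex.
case: i xi imin => [|i] xi imin; first by move: xi; rewrite a0 ltNge x0.
exists i; first by rewrite imin.
by rewrite xi andbT leNgt; apply/negP => /imin; rewrite ltnn.
Qed.

Definition geom n : R := \sum_(i < n) lambda ^+ i.

Lemma geomS n : geom n.+1 = lambda * geom n + 1.
Proof.
rewrite /geom big_ord_recl expr0 addrC mulr_sumr; congr (_ + _).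
by apply: eq_bigr => i _; rewrite exprS.
Qed.

Lemma geomD n N : geom (n + N) = lambda ^+ N * geom n + geom N.
Proof.
elim: N => [|N IH]; first by rewrite addn0 expr0 mul1r {3}/geom big_ord0 addr0.
by rewrite addnS !geomS IH exprS; ring.
Qed.

Lemma geom_closed n : geom n * (1 - lambda) = 1 - lambda ^+ n.
Proof.
elim: n => [|n IH]; first by rewrite /geom big_ord0 mul0r expr0 subrr.
by rewrite geomS mulrDl -mulrA IH exprS; ring.
Qed.

Lemma norm_exp_le1 n : `|lambda ^+ n| <= 1.
Proof. by rewrite normrX exprn_ile1// ltW. Qed.

(** The slope of the iterates in delta stays away from 0 uniformly in [n]: geom n (1 - lambda) = 1 -
    lambda^n is at least 1 - |lambda|, and 1 - lambda < 2. *)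
Lemma geom_ge n : (0 < n)%N -> (1 - `|lambda|) / 2 <= geom n.
Proof.
case: n => // n _.
have := geom_closed n.+1; have : `|lambda ^+ n.+1| <= `|lambda|.
  by rewrite normrX exprS ler_piMr// exprn_ile1// ltW.
move: lambda_lt1; rewrite ltr_norml => /andP[l1 l2].
have le_exp := ler_norm (lambda ^+ n.+1) => exp_le gE.
have gl : 1 - `|lambda| <= geom n.+1 * (1 - lambda) by rewrite gE; lra.
have g0 : 0 <= geom n.+1.
  have l0 : 0 < 1 - lambda by lra.
  by rewrite -(pmulr_lge0 _ l0); apply: le_trans gl; rewrite subr_ge0 ltW.
by rewrite ler_pdivrMr//; apply: le_trans gl _; rewrite ler_wpM2l//; lra.
Qed.

(** The sum of the series of all |lambda|^i, which bounds the slope in delta of every iterate. *)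
Definition slope_bound : R := (1 - `|lambda|)^-1.

Lemma slope_bound_gt0 : 0 < slope_bound.
Proof. by rewrite invr_gt0 subr_gt0. Qed.

Lemma geom_le n : `|geom n| <= slope_bound.
Proof.
have G0 := slope_bound_gt0.
have GE : slope_bound = `|lambda| * slope_bound + 1.
  by rewrite /slope_bound; field; rewrite subr_eq0 eq_sym lt_eqF.
elim: n => [|n IH]; first by rewrite /geom big_ord0 normr0 ltW.
rewrite geomS GE; apply: le_trans (ler_normD _ _) _.
by rewrite normrM normr1 lerD2r ler_wpM2l.
Qed.

(* The dependence of the n-th iterate on (delta, x), up to the locally constant
   offset; it is the same for all branches. *)
Definition lin n (p : R * R) : R := lambda ^+ n * p.2 + geom n * p.1.

Definition offset n (p : R * R) : R := iter n (rot p.1) p.2 - lin n p.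

Lemma iter_rotE n p : iter n (rot p.1) p.2 = lin n p + offset n p.
Proof. by rewrite /offset addrC subrK. Qed.

Lemma offsetD n N p :
  offset (n + N) p =
  lambda ^+ N * offset n p + offset N (p.1, iter n (rot p.1) p.2).
Proof.
rewrite /offset /lin /= geomD addnC iterD addnC exprD; ring.
Qed.

(** With delta in a unit interval from [z], the sum f y + delta lies in [z, z + 2), so its floor is
    [z] or [z + 1]. *)
Definition family_box z : set (R * R) :=
  [set p | z%:~R <= p.1 < z%:~R + 1 /\ I p.2].

Lemma family_box_iter z n p : family_box z p ->
  family_box z (p.1, iter n (rot p.1) p.2).
Proof. by move=> [p1 p2]; split => //; exact: rot_iter_unit. Qed.

(** The next offset depends only on the present one, on the piece reached, and on one comparison
    that decides the floor in the rotation. *)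
Lemma offsetS z n p i : family_box z p -> (i < k)%N ->
  a i <= iter n (rot p.1) p.2 < a i.+1 ->
  offset n.+1 p = lambda * offset n p + b i -
    (if z%:~R + 1 - lambda * offset n p - b i <= lin n.+1 p
     then z%:~R + 1 else z%:~R).
Proof.
move=> [/andP[zp pz] p2] ik yi; set y := iter n _ _ in yi.
have fy := f_affine ik yi.
have := f_unit (rot_iter_unit p.1 n p2); rewrite -/y unit_icoE => /andP[fy0 fy1].
have yE : y = lin n p + offset n p := iter_rotE n p.
have linS : lin n.+1 p = lambda * lin n p + p.1.
  by rewrite /lin exprS geomS; ring.
have fyE : f y + p.1 = lin n.+1 p + lambda * offset n p + b i.
  by rewrite fy yE linS; ring.
rewrite {1}/offset iterS -/y /rot /= /rotation.
case: ifPn => [h|]; last rewrite -ltNge => h.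
  rewrite (@fractional_part_eq (z + 1)) ?intrD ?fyE; first by lra.
  by move: h fyE fy0 fy1 zp pz; lra.
rewrite (@fractional_part_eq z) ?fyE; first by lra.
by move: h fyE fy0 fy1 zp pz; lra.
Qed.

Definition branch_constants z : seq R :=
  [seq b i - u | i <- iota 0 k, u <- [:: z%:~R + 1; z%:~R]].

(** A crude list containing all offsets at time [n]. Its exponential length is harmless, since it
    only serves to make the thresholds of each level finite in number. *)
Fixpoint offset_values z n : seq R :=
  if n is m.+1 then
    [seq lambda * c + d | c <- offset_values z m, d <- branch_constants z]
  else [:: 0].

(** The values of [lin n] at which the iterate meets a breakpoint, followed by those at which the
    rotation of the step leading to time [n] changes its floor. *)
Definition thresholds z n : seq R :=
  [seq a i - c | c <- offset_values z n, i <- iota 0 k.+1] ++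
  [seq z%:~R + 1 - lambda * c - b i | c <- offset_values z n.-1, i <- iota 0 k].

Lemma offset_in_values z n p : family_box z p -> offset n p \in offset_values z n.
Proof.
move=> zp; elim: n => [|n IH].
  by rewrite inE /offset /lin /geom big_ord0 /= expr0; apply/eqP; ring.
have [i ik yi] := piece_exists (rot_iter_unit p.1 n zp.2).
rewrite (offsetS zp ik yi) -addrA; apply: allpairs_f => //.
apply: (@allpairs_f _ _ _ (fun i u => b i - u)); first by rewrite mem_iota.
by case: ifP => _; rewrite !inE eqxx ?orbT.
Qed.

(** By induction the offsets agree so far. Then equal sides of the breakpoint thresholds give the
    same piece, and equal sides of the rotation thresholds give the same floor. *)
Lemma offset_determined z N p q : family_box z p -> family_box z q ->
  (forall j, (j <= N)%N -> forall tau, tau \in thresholds z j ->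
     (tau <= lin j p) = (tau <= lin j q)) ->
  offset N p = offset N q.
Proof.
move=> zp zq; elim: N => [_|N IH same].
  by rewrite /offset /lin /geom !big_ord0 /= expr0; ring.
have {IH} oN : offset N p = offset N q.
  by apply: IH => j jN; apply: same; exact: leqW.
have [i ik yi] := piece_exists (rot_iter_unit p.1 N zp.2).
have cut j : (j <= k)%N ->
    (a j <= iter N (rot p.1) p.2) = (a j <= iter N (rot q.1) q.2).
  move=> jk; rewrite !iter_rotE -oN -2!(lerBlDr _ (offset N p)); apply: same => //.
  rewrite mem_cat (@allpairs_f _ _ _ (fun c i => a i - c)) ?mem_iota//.
  exact: offset_in_values.
have yi' : a i <= iter N (rot q.1) q.2 < a i.+1.
  by rewrite -cut ?(ltnW ik)// ltNge -cut// -ltNge.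
rewrite (offsetS zp ik yi) (offsetS zq ik yi') -oN same//.
rewrite mem_cat (@allpairs_f _ _ _ (fun c i => z%:~R + 1 - lambda * c - b i)) ?orbT//.
  exact: offset_in_values.
by rewrite mem_iota.
Qed.

(** The bound of [plane_signs_card] for N + 1 lines, one per time from 0 to [N]. *)
Definition local_complexity N : nat := (2 * N.+1 ^ 2 + 1)%N.

(** The assumed distance dominates the variation of every [lin j], so on [S] each level has one
    relevant threshold [kappa j], and the signs of the forms lin j - kappa j determine the
    offset. *)
Lemma offset_local_complexity z N : exists2 e : R, 0 < e &
  forall S : set (R * R), S `<=` family_box z ->
  (forall p q, S p -> S q -> `|p.2 - q.2| + slope_bound * `|p.1 - q.1| < e) ->
  takes_at_most (offset N) S (local_complexity N).
Proof.
have [e e0 eP] := one_threshold_levels (thresholds z) N.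
exists e => // S Sz Se.
have [j jN _ _ [p Sp <-] [q Sq <-]|kappa kP] := eP (fun j => lin j @` S).
  apply: le_lt_trans (Se _ _ Sp Sq).
  have -> : lin j p - lin j q = lambda ^+ j * (p.2 - q.2) + geom j * (p.1 - q.1).
    by rewrite /lin; ring.
  apply: le_trans (ler_normD _ _) _; rewrite !normrM lerD//.
    by rewrite ler_piMl// norm_exp_le1.
  by rewrite ler_wpM2r// geom_le.
pose L := [seq ((geom j, lambda ^+ j), - kappa j) | j <- iota 0 N.+1].
have [s sL sP] := plane_signs_card L.
apply: (@takes_at_most_factor _ _ _ _ (plane_signs L)).
  exists s => [|p _]; last exact: sP.
  by rewrite size_map size_iota in sL.
move=> p q Sp Sq pq; apply: (offset_determined (Sz _ Sp) (Sz _ Sq)) => j jN.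
apply: kP => //.
move: pq; rewrite /plane_signs -!map_comp => /eq_in_map/(_ j).
rewrite mem_iota /= add0n ltnS => /(_ jN).
by rewrite !subr_ge0 /lin ![geom j * _ + _]addrC.
Qed.

(** Two points with the same offset at time t N have iterates at distance at most |dx| + slope_bound
    |d delta|. The factor 2 leaves room for this growth, so the local bound applies to every block
    of [N] steps with the same [e]. *)
Lemma offset_box_complexity z N : exists2 e : R, 0 < e &
  forall S : set (R * R), S `<=` family_box z ->
  (forall p q, S p -> S q ->
     `|p.2 - q.2| + 2 * slope_bound * `|p.1 - q.1| < e) ->
  forall t, takes_at_most (offset (t * N)) S (local_complexity N ^ t).
Proof.
have [e e0 eP] := offset_local_complexity z N.
exists e => // S Sz Se; elim=> [|t IH].
  rewrite mul0n expn0; exists [:: 0] => // p _.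
  by rewrite inE /offset /lin /geom big_ord0 /= expr0; apply/eqP; ring.
rewrite expnSr; apply: (takes_at_most_fibers IH) => c.
(* The points with offset [c] at time t N, moved to that time. *)
pose S' := [set (p.1, iter (t * N) (rot p.1) p.2) |
            p in S `&` [set p | offset (t * N) p = c]].
have [_ [p [Sp _] <-]|_ _ [p [Sp pc] <-] [q [Sq qc] <-]|l ln lP] := eP S'.
- by apply: family_box_iter; exact: Sz.
- move: pc qc => /= pc qc; rewrite !iter_rotE pc qc.
  apply: le_lt_trans (Se _ _ Sp Sq).
  have -> : lin (t * N) p + c - (lin (t * N) q + c) =
     lambda ^+ (t * N) * (p.2 - q.2) + geom (t * N) * (p.1 - q.1).
    by rewrite /lin; ring.
  have := ler_normD (lambda ^+ (t * N) * (p.2 - q.2)) (geom (t * N) * (p.1 - q.1)).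
  rewrite !normrM.
  have := ler_wpM2r (normr_ge0 (p.2 - q.2)) (norm_exp_le1 (t * N)).
  have := ler_wpM2r (normr_ge0 (p.1 - q.1)) (geom_le (t * N)).
  by lra.
- exists [seq lambda ^+ N * c + d | d <- l]; first by rewrite size_map.
  move=> p [Sp pc]; rewrite mulSn addnC offsetD pc map_f//.
  by apply: lP; exists p.
Qed.

(** The box is cut into finitely many squares small enough for the previous lemma; [M] is their
    number, independent of [t]. *)
Lemma offset_complexity z N : exists M : nat, forall t,
  takes_at_most (offset (t * N)) (family_box z) (M * local_complexity N ^ t).
Proof.
have [e e0 eP] := offset_box_complexity z N.
have G0 := slope_bound_gt0.
pose c := 1 + 2 * slope_bound; have c0 : 0 < c by rewrite /c; lra.
pose e' := e / (2 * c); have e'0 : 0 < e' by rewrite divr_gt0// mulr_gt0.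
pose g (p : R * R) := (cell e' (p.1 - z%:~R), cell e' p.2).
exists (cells e' * cells e')%N => t; apply: (@takes_at_most_fibers _ _ _ _ g).
  exists [seq (i, j) | i <- iota 0 (cells e'), j <- iota 0 (cells e')].
    by rewrite size_allpairs !size_iota.
  move=> p [/andP[zp pz]]; rewrite unit_icoE => p2.
  by apply: allpairs_f; rewrite mem_iota add0n cell_lt//; lra.
move=> v; apply: eP => [p []//|p q [[/andP[zp pz] p2] pv] [[/andP[zq qz] q2] qv]].
move: p2 q2; rewrite !unit_icoE => /andP[p20 _] /andP[q20 _].
have [E1 E2] : cell e' (p.1 - z%:~R) = cell e' (q.1 - z%:~R) /\
    cell e' p.2 = cell e' q.2.
  by move: qv; rewrite -{}pv => -[-> ->].
have d2 := cell_eq_close e'0 p20 q20 E2.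
have d1 : `|p.1 - q.1| <= e'.
  rewrite (_ : p.1 - q.1 = p.1 - z%:~R - (q.1 - z%:~R)); last by ring.
  by apply: cell_eq_close => //; rewrite subr_ge0.
apply: (@le_lt_trans _ _ (c * e')).
  have -> : c * e' = e' + 2 * slope_bound * e' by rewrite /c; ring.
  by apply: lerD => //; rewrite ler_wpM2l//; lra.
have -> : c * e' = e / 2 by rewrite /e'; field; rewrite gt_eqF.
by lra.
Qed.

(** * Asymptotic periodicity when an iterated image avoids the breakpoints *)

Section AvoidingBreakpoints.
Variables (delta : R) (n : nat) (r : R).
Hypothesis r_gt0 : 0 < r.
Hypothesis avoid : forall x, I x -> forall j, (j <= k)%N ->
  r < `|iter n (rot delta) x - a j|.

Local Notation h := (rot delta).

(** Later iterates are again [n]-th iterates, so they avoid the breakpoints too. *)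
Lemma iter_avoid x i : I x -> exists2 x', I x' & iter i h (iter n h x) = iter n h x'.
Proof.
move=> Ix; exists (iter i h x); first exact: rot_iter_unit.
by rewrite -!iterD addnC.
Qed.

Lemma avoid_bounds x : I x -> r < iter n h x < 1 - r.
Proof.
move=> Ix; have := rot_iter_unit delta n Ix; rewrite unit_icoE => /andP[y0 y1].
have := avoid Ix (leq0n k); have := avoid Ix (leqnn k).
rewrite a0 ak subr0 (ger0_norm y0) ltr0_norm ?subr_lt0//.
by move=> ? ?; apply/andP; split; lra.
Qed.

Lemma near_avoid_unit x y : I x -> `|y - iter n h x| <= r -> I y.
Proof.
move=> /avoid_bounds; rewrite unit_icoE ler_norml => /andP[? ?] /andP[? ?].
by apply/andP; split; lra.
Qed.

(** Being more than [r] away from the breakpoints puts [y] in the piece of [w]. The image of [w] is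
    also more than [r] away from 0 and 1, so the rotation subtracts the same integer at both
    points. *)
Lemma rot_near_avoid x y : I x -> `|y - iter n h x| <= r ->
  h y - h (iter n h x) = lambda * (y - iter n h x).
Proof.
move=> Ix; set w := iter n h x => yw.
have Iw : I w by exact: rot_iter_unit.
have [i ik /andP[wi iw]] := piece_exists Iw.
have ywi : a i <= y < a i.+1.
  have wi' : 0 <= w - a i by rewrite subr_ge0.
  have iw' : w - a i.+1 < 0 by rewrite subr_lt0.
  have := avoid Ix (ltnW ik); have := avoid Ix ik; rewrite -/w.
  rewrite (ger0_norm wi') (ltr0_norm iw'); move: yw; rewrite ler_norml.
  by move=> /andP[? ?] ? ?; apply/andP; split; lra.
have fw : f w = lambda * w + b i by rewrite (f_affine ik)// wi.
have fy : f y = lambda * y + b i by rewrite (f_affine ik).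
have [x' Ix' hw] := iter_avoid 1 Ix; rewrite /= -/w in hw.
have := avoid_bounds Ix'; rewrite -hw => /andP[hw0 hw1].
rewrite /rot /= /rotation in hw0 hw1 *.
set m := Num.floor (f w + delta).
have hwE : fractional_part (f w + delta) = f w + delta - m%:~R by [].
have lyw : `|lambda * (y - w)| <= r.
  by rewrite normrM; apply: le_trans yw; rewrite ler_piMl// ltW.
suff -> : fractional_part (f y + delta) = f y + delta - m%:~R.
  by rewrite hwE fy fw; ring.
apply: fractional_part_eq; rewrite fy.
rewrite hwE fw in hw0 hw1; move: lyw; rewrite ler_norml mulrBr => /andP[? ?].
by apply/andP; split; lra.
Qed.

Lemma iter_near_avoid x y i : I x -> `|y - iter n h x| <= r ->
  iter i h y - iter i h (iter n h x) = lambda ^+ i * (y - iter n h x).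
Proof.
move=> Ix yw; elim: i => [|i IH]; first by rewrite expr0 mul1r.
have [x' Ix' E] := iter_avoid i Ix.
rewrite !iterS E rot_near_avoid// -E IH ?exprS ?mulrA//.
by rewrite normrM; apply: le_trans yw; rewrite ler_piMl// norm_exp_le1.
Qed.

Lemma iterMfix (T : Type) (g : T -> T) (p : T) m i :
  iter m g p = p -> iter (i * m) g p = p.
Proof. by move=> gp; elim: i => //= i IH; rewrite mulSn iterD IH. Qed.

Lemma exp_neq1 m : (0 < m)%N -> 1 - lambda ^+ m != 0.
Proof.
case: m => // m _; rewrite subr_eq0 eq_sym; apply: contraTneq lambda_lt1 => l1.
rewrite -leNgt -(@ler_pXn2r _ m.+1) ?nnegrE// expr1n -normrX l1 normr1//.
Qed.

Definition periodic_points : set R :=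
  [set p | I p /\ exists2 m, (0 < m)%N & iter m h p = p].

Lemma periodic_points_avoid p : periodic_points p -> exists2 x, I x & p = iter n h x.
Proof.
(* Going back [n] steps on the cycle amounts to going forward n m - n steps. *)
move=> [Ip [m m0 mp]]; exists (iter (n * m - n) h p); first exact: rot_iter_unit.
by rewrite -iterD subnKC ?leq_pmulr// iterMfix.
Qed.

(** A common period fixes both points but multiplies their difference by a power of lambda other
    than 1. *)
Lemma periodic_points_separated p q : periodic_points p -> periodic_points q ->
  `|p - q| <= r -> p = q.
Proof.
move=> [Ip [m m0 mp]] qP; have [_ [m' m'0 mq]] := qP.
have [x Ix qx] := periodic_points_avoid qP; move=> pq.
rewrite qx in pq; have := iter_near_avoid (m' * m) Ix pq.
rewrite -qx (iterMfix _ mp) mulnC (iterMfix _ mq) => E.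
have /eqP : (p - q) * (1 - lambda ^+ (m * m')) = 0 by rewrite mulrBr mulr1 {1}E; ring.
rewrite mulf_eq0 (negbTE (exp_neq1 _)) ?muln_gt0 ?m0// orbF subr_eq0.
by move/eqP.
Qed.

(** By separation, each cell of length [r] contains at most one periodic point. *)
Lemma finite_periodic_points : finite_set periodic_points.
Proof.
have /choice[c cP] : forall i, exists p, (exists2 q, periodic_points q & cell r q = i) ->
    periodic_points p /\ cell r p = i.
  move=> i; have [[q qP qi]|nq] :=
    pselect (exists2 q, periodic_points q & cell r q = i); last by exists 0.
  by exists q.
apply: sub_finite_set (finite_image c (finite_II (cells r))) => p pP.
have [] := pP; rewrite unit_icoE => p01 _.
exists (cell r p); first exact: cell_lt.
have [cP1 cP2] := cP (cell r p) (ex_intro2 _ _ p pP erefl).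
apply: periodic_points_separated => //; apply: cell_eq_close => //.
  by case: cP1; rewrite unit_icoE => /andP[].
by case/andP: p01.
Qed.

(* Two close points of the orbit give a return map that is affine near them, so
   the periodic point is the explicit fixed point of that affine map. *)
Lemma orbit_shadows_periodic x : I x -> exists m q, [/\ periodic_points q &
  forall i, `|iter i h q - iter (m + i) h x| <= `|lambda| ^+ i * r].
Proof.
move=> Ix; pose u i := iter (n + i) h x.
have uE i : u i = iter n h (iter i h x) by rewrite /u iterD.
have Ixi i : I (iter i h x) by exact: rot_iter_unit.
(* This closeness of two orbit points keeps the fixed point within [r] of [u i], as |1 - lambda^p|
   is at least 1 - |lambda|. *)
have e0 : 0 < r * (1 - `|lambda|) by rewrite mulr_gt0 ?subr_gt0.
have u01 i : 0 <= u i < 1 by rewrite uE -unit_icoE; exact: rot_iter_unit.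
have [i [j [ij uij]]] := cell_pigeonhole e0 u01.
pose p := (j - i)%N; have p0 : (0 < p)%N by rewrite subn_gt0.
pose q := u i + (u j - u i) / (1 - lambda ^+ p).
have lp := exp_neq1 p0.
have qu : `|q - u i| <= r.
  rewrite /q addrAC subrr add0r normrM normfV distrC ler_pdivrMr ?normr_gt0//.
  apply: le_trans uij _; rewrite ler_pM2l//.
  apply: le_trans (lerB_dist _ _); rewrite normr1 lerB// normrX.
  by case: (p) p0 => // p' _; rewrite exprS ler_piMr// exprn_ile1// ltW.
have near := iter_near_avoid _ (Ixi i); rewrite -uE in near.
have ujE : iter p h (u i) = u j by rewrite /u -iterD addnA addnAC subnK ?(ltnW ij)// addnC.
exists (n + i)%N, q; split.
  split; first by apply: (near_avoid_unit (Ixi i)); rewrite -uE.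
  exists p => //; have := near _ p qu; rewrite ujE => /eqP; rewrite subr_eq => /eqP ->.
  by rewrite /q; field.
move=> l; have := near _ l qu; rewrite /u -iterD addnC => ->.
by rewrite normrM normrX ler_wpM2l// exprn_ge0.
Qed.

Lemma omega_limit_shadow x m q : I q -> (exists2 p, (0 < p)%N & iter p h q = q) ->
  (forall i, `|iter i h q - iter (m + i) h x| <= `|lambda| ^+ i * r) ->
  omega_limit h x = range (fun i => iter i h q).
Proof.
move=> Iq [p p0 pq] shadow.
have iter_mod i : iter i h q = iter (i %% p) h q.
  by rewrite {1}(divn_eq i p) addnC iterD iterMfix.
have small e : 0 < e -> exists J, forall i, (J <= i)%N ->
    `|iter i h q - iter (m + i) h x| < e.
  move=> e0; have [|J JP] := @exp_eventually_small R lambda (e / r) lambda_lt1.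
    by rewrite divr_gt0.
  by exists J => i /JP; rewrite ltr_pdivlMr//; exact: le_lt_trans.
apply/seteqP; split => [c [Ic cc]|_ [i _ <-]].
  apply: contrapT => nc.
  (* A point off the finite cycle has a positive distance from it, while the orbit of [x] approaches
     the cycle. *)
  have [|e e0 eP] := @seq_pos_lower_bound R _ (iota 0 p) (fun i => `|c - iter i h q|).
    move=> i _; rewrite normr_gt0 subr_eq0; apply/eqP => ci; apply: nc.
    by exists i.
  have e20 : 0 < e / 2 by lra.
  have [J JP] := small _ e20.
  have [||_ [[i /= Ji <-] ic]] := cc [set iter i h x | i in [set i | (m + J <= i)%N]]
      (ball c (e / 2)).
  - by exists (m + J)%N => // i /= Ji; exists i.
  - exact: nbhsx_ballx.
  - move: ic; rewrite /ball /= => ic.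
    have {}Ji : exists2 l, i = (m + l)%N & (J <= l)%N.
      by exists (i - m)%N; lia.
    case: Ji => l li Jl; have := JP _ Jl; rewrite -li.
    have := eP (l %% p)%N; rewrite mem_iota /= add0n ltn_mod p0 -iter_mod => /(_ isT).
    have := ler_distD (iter i h x) c (iter l h q).
    rewrite [`|iter i h x - _|]distrC; lra.
split; first exact: rot_iter_unit.
move=> A B [J _ JA] /nbhs_ballP[e /= e0 eB].
have [J' JP] := small _ e0.
(* A late time congruent to [i] modulo the period. *)
pose l := (i + (J + J') * p)%N.
have lJ : (J + J' <= l)%N.
  apply: leq_trans (leq_addl _ _); exact: leq_pmulr.
exists (iter (m + l) h x); split; first by apply: JA; rewrite /=; lia.
apply: eB; rewrite /ball /=.
have -> : iter i h q = iter l h q by rewrite /l iterD iterMfix.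
by apply: JP; lia.
Qed.

Lemma asymptotically_periodic_avoid : asymptotically_periodic h.
Proof.
split.
  apply: sub_finite_set (finite_image (fun p => range (fun i => iter i h p))
    finite_periodic_points) => O [p [Ip perp ->]].
  by exists p.
move=> x Ix; have [m [q [[Iq perq] shadow]]] := orbit_shadows_periodic Ix.
by exists q; split => //; exact: omega_limit_shadow shadow.
Qed.

End AvoidingBreakpoints.

(** * Covering the exceptional set *)

Lemma exceptional_near_breakpoint delta n r : exceptional_set f delta -> 0 < r ->
  exists x j, [/\ I x, (j <= k)%N & `|iter n (rot delta) x - a j| <= r].
Proof.
move=> ex r0; apply: contrapT => far; apply: ex.
apply: (@asymptotically_periodic_avoid delta n r) => // x Ix j jk.
by rewrite ltNge; apply/negP => near; apply: far; exists x, j.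
Qed.

(** For two members, geom n |d - d'| is at most 2 theta^n from the breakpoint plus theta^n from the
    difference of the starting points; [geom_ge] turns 3 into 6 / (1 - |lambda|). *)
Lemma near_breakpoint_diameter n c y theta : (0 < n)%N -> `|lambda| <= theta ->
  (diameter [set delta : R | exists2 x, I x &
    (`|lin n (delta, x) + c - y| <= theta ^+ n)%R] <=
   (6 / (1 - `|lambda|) * theta ^+ n)%:E)%E.
Proof.
move=> n0 ltheta; apply: diameter_le => d d' [x Ix dx] [x' Ix' dx'].
have gn := geom_ge n0; have l0 : 0 < 1 - `|lambda| by rewrite subr_gt0.
have g0 : 0 < geom n by apply: lt_le_trans gn; lra.
have le1 : `|lambda ^+ n * (x - x')| <= theta ^+ n.
  rewrite normrM normrX -[leRHS]mulr1.
  apply: ler_pM => //.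
    by rewrite lerXn2r ?nnegrE//; exact: le_trans ltheta.
  move: Ix Ix'; rewrite !unit_icoE ler_norml => /andP[? ?] /andP[? ?].
  by apply/andP; split; lra.
have gd : geom n * `|d - d'| <= 3 * theta ^+ n.
  rewrite -{1}(gtr0_norm g0) -normrM.
  have -> : geom n * (d - d') = (lin n (d, x) + c - y) - (lin n (d', x') + c - y)
      - lambda ^+ n * (x - x') by rewrite /lin /=; ring.
  apply: le_trans (ler_normB _ _) _; have := ler_normB (lin n (d, x) + c - y)
    (lin n (d', x') + c - y); lra.
have lg : (1 - `|lambda|) * `|d - d'| <= 6 * theta ^+ n.
  have : (1 - `|lambda|) / 2 * `|d - d'| <= geom n * `|d - d'| by rewrite ler_wpM2r.
  lra.
by rewrite mulrAC ler_pdivlMr// mulrC.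
Qed.

(** With u = 1/r - 1, Bernoulli gives r^N N u <= 1. The cube of this beats the quadratic bound 9
    N^2, leaving 9 / (N u^3), which is below 1 for the chosen [N]. *)
Lemma local_complexity_subexponential (r : R) : 0 < r < 1 ->
  exists2 N, (0 < N)%N & (local_complexity N)%:R * (r ^+ 3) ^+ N < 1.
Proof.
move=> /andP[r0 r1]; pose u := r^-1 - 1.
have u0 : 0 < u by rewrite subr_gt0 invf_gt1.
have bernoulli N : r ^+ N * (1 + u * N%:R) <= 1.
  elim: N => [|N IH]; first by rewrite expr0 mulr0 addr0 mulr1.
  apply: le_trans IH; rewrite exprSr -mulrA ler_pM2l ?exprn_gt0//.
  have -> : r * (1 + u * N.+1%:R) = 1 + u * N%:R * r.
    by rewrite -natr1 /u; field; rewrite gt_eqF.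
  by rewrite lerD2l; apply: ler_piMr; rewrite ?mulr_ge0// ltW.
pose N := (Num.truncn (9 / u ^+ 3)).+1.
have N1 : (1 : R) <= N%:R by rewrite ler1n.
have uN : 9 < N%:R * u ^+ 3 by rewrite -ltr_pdivrMr ?exprn_gt0// truncnS_gt.
exists N => //; rewrite exprAC; set v := r ^+ N.
have v0 : 0 < v by rewrite exprn_gt0.
have vN : v * N%:R * u <= 1.
  apply: le_trans (bernoulli N); rewrite -/v.
  have -> : v * (1 + u * N%:R) = v + v * N%:R * u by ring.
  by rewrite lerDr ltW.
have PN : (local_complexity N)%:R <= 9 * N%:R ^+ 2 :> R.
  by rewrite -natrX -natrM ler_nat /local_complexity; nia.
rewrite -(ltr_pM2r (_ : 0 < N%:R * u ^+ 3)); last by lra.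
rewrite mul1r; apply: le_lt_trans uN.
have cube : (v * N%:R * u) ^+ 3 <= 1.
  by rewrite exprn_ile1// !mulr_ge0// ltW.
apply: (@le_trans _ _ (9 * (v * N%:R * u) ^+ 3)); last by lra.
have -> : 9 * (v * N%:R * u) ^+ 3 = 9 * N%:R ^+ 2 * (v ^+ 3 * (N%:R * u ^+ 3)) by ring.
by rewrite -[leLHS]mulrA; apply: ler_wpM2r => //; rewrite !mulr_ge0 ?exprn_ge0 ?ltW.
Qed.

Lemma powR_exprn (x s : R) n : 0 <= x -> (x ^+ n) `^ s = (x `^ s) ^+ n.
Proof.
by move=> x0; rewrite -powR_mulrn// -powRrM mulrC powRrM powR_mulrn// powR_ge0.
Qed.

(** At time n = t N at most M P^t (k + 1) sets of diameter D theta^n cover the slice, so the sum of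
    their [s]-th powers is at most C (P rho^N)^t, which tends to 0 as [t] grows. *)
Lemma exceptional_slice_null (s : R) z : 0 < s ->
  hausdorff_measure s (exceptional_set f `&`
    [set delta | z%:~R <= delta < z%:~R + 1]) = 0%E.
Proof.
(* The maximum with 1/2 keeps the radii theta^n positive when lambda = 0. *)
move=> s0; pose theta : R := Num.max `|lambda| 2^-1.
have ltheta : `|lambda| <= theta by rewrite le_max lexx.
have theta0 : 0 < theta by rewrite lt_max; apply/orP; right; lra.
have theta1 : theta < 1 by rewrite gt_max lambda_lt1; lra.
pose rho := theta `^ s.
(* The exponent s / 3 makes the cube in that lemma equal to [rho]. *)
have [|N N0 PN] := @local_complexity_subexponential (theta `^ (s / 3)).
  have s3 : 0 < s / 3 by lra.
  have := gt0_ltr_powR s3 (ltW theta0 : theta \in Num.nneg) (ler01 : 1 \in Num.nneg) theta1.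
  by rewrite powR_gt0//= powR1.
have rhoE : rho = (theta `^ (s / 3)) ^+ 3.
  by rewrite -powR_mulrn ?powR_ge0// -powRrM divfK ?pnatr_eq0.
rewrite -rhoE in PN.
set P := local_complexity N in PN.
have [M MP] := offset_complexity z N.
pose D := 6 / (1 - `|lambda|).
have D0 : 0 < D by rewrite divr_gt0// subr_gt0.
pose C := (M * k.+1)%:R * D `^ s.
have C0 : 0 <= C by rewrite mulr_ge0 ?powR_ge0.
apply: hausdorff_measure_eq0 => e eta e0 eta0.
have [||J1 J1P] := @exp_eventually_small R theta (e / D).
- by rewrite ger0_norm// ltW.
- by rewrite divr_gt0.
have PN0 : 0 <= P%:R * rho ^+ N by rewrite mulr_ge0// exprn_ge0// powR_ge0.
(* [C] is only known to be nonnegative, hence the division by [C + 1]. *)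
have [||J2 J2P] := @exp_eventually_small R (P%:R * rho ^+ N) (eta / (C + 1)).
- by rewrite ger0_norm.
- by rewrite divr_gt0//; lra.
rewrite (ger0_norm PN0) (ger0_norm (ltW theta0)) in J1P J2P.
have [t [t0 tJ1 tJ2]] : exists t, [/\ 0 < t, J1 <= t & J2 <= t]%N.
  by exists (J1 + J2).+1; split=> //; apply: leqW; rewrite ?leq_addr ?leq_addl.
pose n := (t * N)%N; pose d := D * theta ^+ n.
have n0 : (0 < n)%N by rewrite muln_gt0 t0.
have de : d <= e.
  rewrite /d mulrC -ler_pdivlMr// ltW// J1P//.
  exact: leq_trans tJ1 (leq_pmulr _ N0).
have d0 : 0 <= d by rewrite mulr_ge0 ?exprn_ge0 ?ltW.
have [l lM lP] := MP t.
pose J c j := [set delta | exists2 x, I x &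
  `|lin n (delta, x) + c - a j| <= theta ^+ n].
pose L := [seq J c j | c <- l, j <- iota 0 k.+1].
apply: le_trans (@hausdorff_premeasure_finite_cover _ s e _ L d _ _ _ _) _.
- exact: ltW.
- by rewrite d0.
- by move=> U /allpairsP[[c j] [_ _ ->]]; exact: near_breakpoint_diameter.
- move=> delta [ex dz].
  have [|x [j [Ix jk near]]] := exceptional_near_breakpoint n ex (r := theta ^+ n).
    by rewrite exprn_gt0.
  exists (J (offset n (delta, x)) j).
    by apply: allpairs_f; [exact: lP|rewrite mem_iota].
  by exists x => //; rewrite -iter_rotE.
rewrite lee_fin.
have ds : d `^ s = D `^ s * (rho ^+ N) ^+ t.
  by rewrite /d powRM ?exprn_ge0 ?ltW// powR_exprn ?ltW// -exprM mulnC.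
have sizeL : (size L)%:R <= (M * k.+1)%:R * P%:R ^+ t :> R.
  rewrite size_allpairs size_iota -natrX -natrM ler_nat mulnAC.
  by rewrite leq_mul2r lM orbT.
apply: (@le_trans _ _ (C * (P%:R * rho ^+ N) ^+ t)).
  rewrite exprMn /C ds.
  have -> : (M * k.+1)%:R * D `^ s * (P%:R ^+ t * (rho ^+ N) ^+ t) =
    (M * k.+1)%:R * P%:R ^+ t * (D `^ s * (rho ^+ N) ^+ t) by ring.
  by rewrite ler_wpM2r// mulr_ge0 ?powR_ge0// !exprn_ge0// powR_ge0.
have /ltW : (P%:R * rho ^+ N) ^+ t < eta / (C + 1) by exact: J2P.
rewrite ler_pdivlMr; last by lra.
have : 0 <= (P%:R * rho ^+ N) ^+ t by rewrite exprn_ge0.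
by lra.
Qed.

Lemma exceptional_dim_eq0 : hausdorff_dim (exceptional_set f) = 0%E.
Proof.
apply: hausdorff_dim_eq0 => s s0.
(* Unit slices enumerated by codes of integers; a number that codes no integer repeats the slice of
   0. *)
pose F (i : nat) := exceptional_set f `&`
  [set delta | (odflt 0 (unpickle i) : int)%:~R <= delta <
               (odflt 0 (unpickle i) : int)%:~R + 1].
have -> : exceptional_set f = \bigcup_i F i.
  apply/seteqP; split => [delta ex|delta [i _ []//]].
  exists (pickle (Num.floor delta)) => //; rewrite /F pickleK; split => //=.
  by rewrite ge_floor; have := floorD1_gt delta; rewrite intrD.
by apply: hausdorff_measure_bigcup_eq0 => i; exact: exceptional_slice_null.
Qed.

End PiecewiseAffineFamily.

Theorem theoremA (R : realType) (lambda : R) (f : R -> R)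
  (hlambda : -1 < lambda < 1) (hf : piecewise_affine lambda f) :
  hausdorff_dim (exceptional_set f) = 0%E.
Proof.
have [f_unit [k [a [b [_ a0 ak _ f_affine]]]]] := hf.
by apply: exceptional_dim_eq0 f_unit a0 ak f_affine; rewrite ltr_norml.
Qed.
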